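(* Soundness of $\mathbf{G3PDL}^{\infty}$: every sequent $\Gamma \Rightarrow \Delta$ that has a $\mathbf{G3PDL}^{\infty}$ proof is valid.
   Context: PDL syntax: with countably many atomic propositions $p$ and atomic programs $a$, formulas and programs are given mutually by $\varphi,\psi ::= \bot \mid p \mid \varphi\wedge\psi \mid \varphi\vee\psi \mid \varphi\rightarrow\psi \mid [\alpha]\varphi$ and $\alpha,\beta ::= a \mid \alpha;\beta \mid \alpha\cup\beta \mid \varphi? \mid \alpha^{*}$. A model $\mathfrak m=(S,I)$ has a set of states $S$, $I(p)\subseteq S$, $I(a)\subseteq S\times S$. The interpretation $[\![\cdot]\!]$ is: $[\![\bot]\!]=\emptyset$, $[\![p]\!]=I(p)$, $\wedge,\vee$ as intersection/union, $[\![\varphi\rightarrow\psi]\!]=(S\setminus[\![\varphi]\!])\cup[\![\psi]\!]$, $[\![[\alpha]\varphi]\!]=\{s \mid \forall t\,((s,t)\in[\![\alpha]\!]\Rightarrow t\in[\![\varphi]\!])\}$; $[\![a]\!]=I(a)$, $[\![\alpha;\beta]\!]=\{(s,u)\mid \exists t\,(s,t)\in[\![\alpha]\!],(t,u)\in[\![\beta]\!]\}$, $[\![\alpha\cup\beta]\!]=[\![\alpha]\!]\cup[\![\beta]\!]$, $[\![\varphi?]\!]=\{(s,s)\mid s\in[\![\varphi]\!]\}$, $[\![\alpha^*]\!]=\bigcup_{k\ge0}[\![\alpha]\!]^k$. Labelled sequents: fix a countable set of labels $x,y,z,\dots$. A relational atom is $x \xrightarrow{a} y$ ($a$ atomic);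 a labelled formula is $x:\varphi$. A sequent $\Gamma\Rightarrow\Delta$ has $\Gamma,\Delta$ finite sets of relational atoms and labelled formulas; ''$A,\Gamma$'' means $\{A\}\cup\Gamma$. A valuation $v$ maps labels to states; $\mathfrak m,v\models x\xrightarrow{a}y$ iff $(v(x),v(y))\in I(a)$; $\mathfrak m,v\models x:\varphi$ iff $v(x)\in[\![\varphi]\!]$; $\mathfrak m,v\models \Gamma\Rightarrow\Delta$ iff whenever all members of $\Gamma$ hold some member of $\Delta$ holds. The sequent is valid if this holds for all models and valuations. Rules of $\mathbf{G3PDL}^{\infty}$ (premises / conclusion): (Ax) $A\Rightarrow A$; ($\bot$) $x:\bot\Rightarrow$; (WL) $\Gamma\Rightarrow\Delta$ / $A,\Gamma\Rightarrow\Delta$; (WR) $\Gamma\Rightarrow\Delta$ / $\Gamma\Rightarrow\Delta,A$; ($\wedge$L) $x:\varphi,x:\psi,\Gamma\Rightarrow\Delta$ / $x:\varphi\wedge\psi,\Gamma\Rightarrow\Delta$; ($\wedge$R) $\Gamma\Rightarrow\Delta,x:\varphi$ and $\Gamma\Rightarrow\Delta,x:\psi$ / $\Gamma\Rightarrow\Delta,x:\varphi\wedge\psi$; ($\vee$L) $x:\varphi,\Gamma\Rightarrow\Delta$ and $x:\psi,\Gamma\Rightarrow\Delta$ / $x:\varphi\vee\psi,\Gamma\Rightarrow\Delta$; ($\vee$R) $\Gamma\Rightarrow\Delta,x:\varphi,x:\psi$ / $\Gamma\Rightarrow\Delta,x:\varphi\vee\psi$; ($\rightarrow$L) $\Gamma\Rightarrow\Delta,x:\varphi$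 and $x:\psi,\Gamma\Rightarrow\Delta$ / $x:\varphi\rightarrow\psi,\Gamma\Rightarrow\Delta$; ($\rightarrow$R) $x:\varphi,\Gamma\Rightarrow\Delta,x:\psi$ / $\Gamma\Rightarrow\Delta,x:\varphi\rightarrow\psi$; ($\Box$L) $y:\varphi,\Gamma\Rightarrow\Delta$ / $x:[a]\varphi,x\xrightarrow{a}y,\Gamma\Rightarrow\Delta$; ($\Box$R) $x\xrightarrow{a}y,\Gamma\Rightarrow\Delta,y:\varphi$ / $\Gamma\Rightarrow\Delta,x:[a]\varphi$ with $y$ fresh; (;L) $x:[\alpha][\beta]\varphi,\Gamma\Rightarrow\Delta$ / $x:[\alpha;\beta]\varphi,\Gamma\Rightarrow\Delta$; (;R) $\Gamma\Rightarrow\Delta,x:[\alpha][\beta]\varphi$ / $\Gamma\Rightarrow\Delta,x:[\alpha;\beta]\varphi$; ($\cup$L) $x:[\alpha]\varphi,x:[\beta]\varphi,\Gamma\Rightarrow\Delta$ / $x:[\alpha\cup\beta]\varphi,\Gamma\Rightarrow\Delta$; ($\cup$R) $\Gamma\Rightarrow\Delta,x:[\alpha]\varphi$ and $\Gamma\Rightarrow\Delta,x:[\beta]\varphi$ / $\Gamma\Rightarrow\Delta,x:[\alpha\cup\beta]\varphi$; (?L) $\Gamma\Rightarrow\Delta,x:\varphi$ and $x:\psi,\Gamma\Rightarrow\Delta$ / $x:[\varphi?]\psi,\Gamma\Rightarrow\Delta$; (?R) $x:\varphi,\Gamma\Rightarrow\Delta,x:\psi$ / $\Gamma\Rightarrow\Delta,x:[\varphi?]\psi$;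 ($*$L) $x:\varphi,x:[\alpha][\alpha^*]\varphi,\Gamma\Rightarrow\Delta$ / $x:[\alpha^*]\varphi,\Gamma\Rightarrow\Delta$; ($*$R) $\Gamma\Rightarrow\Delta,x:\varphi$ and $\Gamma\Rightarrow\Delta,x:[\alpha][\alpha^*]\varphi$ / $\Gamma\Rightarrow\Delta,x:[\alpha^*]\varphi$; (Subst) $\Gamma\Rightarrow\Delta$ / $\Gamma[x/y]\Rightarrow\Delta[x/y]$ (replace label $x$ by $y$ everywhere); (Cut) $\Gamma\Rightarrow\Delta,A$ and $A,\Sigma\Rightarrow\Pi$ / $\Gamma,\Sigma\Rightarrow\Delta,\Pi$. The displayed formula in the conclusion is the principal formula; the displayed formulas in premises are its immediate ancestors. A pre-proof is a possibly infinite tree of rule instances (no open leaves); a path is a sequence of sequents starting at the root, each next one a premise of the previous. A trace value is $\tau=(x,\alpha_1\cdots\alpha_n,\beta,\varphi)$, $n\ge0$, identified with the labelled formula $x:[\alpha_1]\cdots[\alpha_n][\beta^*]\varphi$; $\alpha_1\cdots\alpha_n$ is its spine. Write $[\gamma]\tau=(x,\gamma\alpha_1\cdots\alpha_n,\beta,\varphi)$ and $y:\tau=(y,\alpha_1\cdots\alpha_n,\beta,\varphi)$. For a rule instance with conclusion $s=\Gamma\Rightarrow\Delta$ and premise $s'=\Gamma'\Rightarrow\Delta'$, $(\tau,\tau')$ is a trace pair if $\tau\in\Delta$, $\tau'\in\Delta'$ and: (1) if $\tau$ is principal, $\tau'$ is its immediate ancestor and: for ($\Box$R) $\tau=x:[a]\tau'$;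 for (?R) $\tau=[\varphi?]\tau'$; for (;R) $\tau=[\alpha;\beta]\tau''$, $\tau'=[\alpha][\beta]\tau''$; for ($\cup$R) $\tau=[\alpha\cup\beta]\tau''$ and $\tau'=[\alpha]\tau''$ (left premise) or $[\beta]\tau''$ (right premise); for ($*$R) $\tau=[\alpha^*]\tau'$ (left premise) or $\tau'=[\alpha]\tau$ (right premise); (2) if $\tau$ is not principal, then $\tau'=\tau$, except for (Subst) where $\tau$ is obtained from $\tau'$ by applying the substitution to its label. The pair is progressing if $\tau$ is principal and has empty spine. A trace $\tau_1,\tau_2,\dots$ follows a path $s_1,s_2,\dots$ if for some $k\ge0$ each $(\tau_i,\tau_{i+1})$ is a trace pair for $(s_{i+k},s_{i+k+1})$; it is infinitely progressing if infinitely many of its pairs are progressing. A $\mathbf{G3PDL}^{\infty}$ proof is a pre-proof in which every infinite path is followed by some infinitely progressing trace. *)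

(* Defs.v *)
From HB Require Import structures.
From mathcomp Require Import all_boot finmap.
From mathcomp Require Import classical_sets.

Set Implicit Arguments.
Unset Strict Implicit.
Unset Printing Implicit Defensive.

Definition atom_prop := nat.
Definition atom_prog := nat.
Definition label := nat.

Inductive formula : Type :=
  | Bot
  | Var of atom_prop
  | And of formula & formula
  | Or of formula & formula
  | Imp of formula & formula
  | Box of program & formula
with program : Type :=
  | Atom of atom_prog
  | Comp of program & program
  | Choose of program & program
  | Test of formula
  | Star of program.

Scheme formula_mut_ind := Induction for formula Sort Prop
  with program_mut_ind := Induction for program Sort Prop.
Combined Scheme formula_program_ind from formula_mut_ind, program_mut_ind.

(* An encoding into generic trees provides the countType structures on which
   {fset _} depends. *)
Fixpoint encode_formula (f : formula) : GenTree.tree nat :=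
  match f with
  | Bot => GenTree.Node 0 [::]
  | Var p => GenTree.Leaf p
  | And f g => GenTree.Node 1 [:: encode_formula f; encode_formula g]
  | Or f g => GenTree.Node 2 [:: encode_formula f; encode_formula g]
  | Imp f g => GenTree.Node 3 [:: encode_formula f; encode_formula g]
  | Box a f => GenTree.Node 4 [:: encode_program a; encode_formula f]
  end
with encode_program (a : program) : GenTree.tree nat :=
  match a with
  | Atom p => GenTree.Leaf p
  | Comp a b => GenTree.Node 0 [:: encode_program a; encode_program b]
  | Choose a b => GenTree.Node 1 [:: encode_program a; encode_program b]
  | Test f => GenTree.Node 2 [:: encode_formula f]
  | Star a => GenTree.Node 3 [:: encode_program a]
  end.

Fixpoint decode_formula (t : GenTree.tree nat) : option formula :=
  match t with
  | GenTree.Node 0 [::] => Some Bot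
  | GenTree.Leaf p => Some (Var p)
  | GenTree.Node 1 [:: t; u] =>
      obind (fun f => omap (And f) (decode_formula u)) (decode_formula t)
  | GenTree.Node 2 [:: t; u] =>
      obind (fun f => omap (Or f) (decode_formula u)) (decode_formula t)
  | GenTree.Node 3 [:: t; u] =>
      obind (fun f => omap (Imp f) (decode_formula u)) (decode_formula t)
  | GenTree.Node 4 [:: t; u] =>
      obind (fun a => omap (Box a) (decode_formula u)) (decode_program t)
  | _ => None
  end
with decode_program (t : GenTree.tree nat) : option program :=
  match t with
  | GenTree.Leaf p => Some (Atom p)
  | GenTree.Node 0 [:: t; u] =>
      obind (fun a => omap (Comp a) (decode_program u)) (decode_program t)
  | GenTree.Node 1 [:: t; u] =>
      obind (fun a => omap (Choose a) (decode_program u)) (decode_program t)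
  | GenTree.Node 2 [:: t] => omap Test (decode_formula t)
  | GenTree.Node 3 [:: t] => omap Star (decode_program t)
  | _ => None
  end.

Lemma encode_formula_programK :
  pcancel encode_formula decode_formula /\
  pcancel encode_program decode_program.
Proof.
by apply: formula_program_ind => //= [f Hf g Hg|f Hf g Hg|f Hf g Hg|a Ha f Hf
  |a Ha b Hb|a Ha b Hb|f ->|a ->] //; rewrite ?Ha ?Hf ?Hg ?Hb.
Qed.

HB.instance Definition _ :=
  Countable.copy formula (pcan_type encode_formula_programK.1).
HB.instance Definition _ :=
  Countable.copy program (pcan_type encode_formula_programK.2).

Section Semantics.
Local Unset Implicit Arguments.
Local Open Scope classical_set_scope.

Record model : Type := Model {
  state : Type;
  prop_interp : atom_prop -> set state;
  prog_interp : atom_prog -> set (state * state) }.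

Definition rel_comp {S : Type} (R Q : set (S * S)) : set (S * S) :=
  [set p | exists t, R (p.1, t) /\ Q (t, p.2)].

Fixpoint rel_pow {S : Type} (R : set (S * S)) (k : nat) : set (S * S) :=
  if k is k'.+1 then rel_comp R (rel_pow R k') else [set p | p.1 = p.2].

Fixpoint interp (m : model) (f : formula) : set (state m) :=
  match f with
  | Bot => set0
  | Var p => prop_interp m p
  | And f g => interp m f `&` interp m g
  | Or f g => interp m f `|` interp m g
  | Imp f g => ~` interp m f `|` interp m g
  | Box a f => [set s | forall t, pinterp m a (s, t) -> interp m f t]
  end
with pinterp (m : model) (a : program) : set (state m * state m) :=
  match a with
  | Atom a => prog_interp m a
  | Comp a b => rel_comp (pinterp m a) (pinterp m b)
  | Choose a b => pinterp m a `|` pinterp m b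
  | Test f => [set p | p.1 = p.2 /\ interp m f p.1]
  | Star a => \bigcup_(k : nat) rel_pow (pinterp m a) k
  end.

End Semantics.

Inductive item : Type :=
  | Rel of label & atom_prog & label
  | Lab of label & formula.

Definition item_to_sum (A : item) : label * atom_prog * label + label * formula :=
  match A with
  | Rel x a y => inl (x, a, y)
  | Lab x f => inr (x, f)
  end.

Definition sum_to_item (A : label * atom_prog * label + label * formula) : item :=
  match A with
  | inl (x, a, y) => Rel x a y
  | inr (x, f) => Lab x f
  end.

Lemma item_to_sumK : cancel item_to_sum sum_to_item.
Proof. by case. Qed.

HB.instance Definition _ := Countable.copy item (can_type item_to_sumK).

Record sequent : Type := Sequent { ante : {fset item}; succ : {fset item} }.

Notation "G =>> D" := (Sequent G D) (at level 70, no associativity).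

Definition sat_item (m : model) (v : label -> state m) (A : item) : Prop :=
  match A with
  | Rel x a y => prog_interp m a (v x, v y)
  | Lab x f => interp m f (v x)
  end.

Definition sat_sequent (m : model) (v : label -> state m) (s : sequent) : Prop :=
  (forall A, A \in ante s -> sat_item v A) ->
  exists2 A, A \in succ s & sat_item v A.

Definition valid (s : sequent) : Prop :=
  forall (m : model) (v : label -> state m), sat_sequent v s.

Definition labels_of (A : item) : seq label :=
  match A with
  | Rel x _ y => [:: x; y]
  | Lab x _ => [:: x]
  end.

Definition fresh (y : label) (s : sequent) : Prop :=
  forall A, A \in ante s \/ A \in succ s -> y \notin labels_of A.

Definition subst_label (x y z : label) : label := if z == x then y else z.

Definition subst_item (x y : label) (A : item) : item :=
  match A with
  | Rel z a w => Rel (subst_label x y z) a (subst_label x y w)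
  | Lab z f => Lab (subst_label x y z) f
  end.

(* The elements of this type are rule instances.  Contexts are sets, so [G] and
   [D] may themselves contain the displayed formulas. *)
Inductive rule : Type :=
  | Ax of item
  | BotL of label
  | WL of item & {fset item} & {fset item}
  | WR of item & {fset item} & {fset item}
  | AndL of label & formula & formula & {fset item} & {fset item}
  | AndR of label & formula & formula & {fset item} & {fset item}
  | OrL of label & formula & formula & {fset item} & {fset item}
  | OrR of label & formula & formula & {fset item} & {fset item}
  | ImpL of label & formula & formula & {fset item} & {fset item}
  | ImpR of label & formula & formula & {fset item} & {fset item}
  | BoxL of label & atom_prog & label & formula & {fset item} & {fset item}
  | BoxR of label & atom_prog & label & formula & {fset item} & {fset item}
  | CompL of label & program & program & formula & {fset item} & {fset item}
  | CompR of label & program & program & formula & {fset item} & {fset item}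
  | ChooseL of label & program & program & formula & {fset item} & {fset item}
  | ChooseR of label & program & program & formula & {fset item} & {fset item}
  | TestL of label & formula & formula & {fset item} & {fset item}
  | TestR of label & formula & formula & {fset item} & {fset item}
  | StarL of label & program & formula & {fset item} & {fset item}
  | StarR of label & program & formula & {fset item} & {fset item}
  | Subst of label & label & {fset item} & {fset item}
  | Cut of item & {fset item} & {fset item} & {fset item} & {fset item}.

Section Rules.
Local Open Scope fset_scope.

Definition conclusion (r : rule) : sequent :=
  match r with
  | Ax A => [fset A] =>> [fset A]
  | BotL x => [fset Lab x Bot] =>> fset0
  | WL A G D => A |` G =>> D
  | WR A G D => G =>> A |` D
  | AndL x f g G D => Lab x (And f g) |` G =>> D
  | AndR x f g G D => G =>> Lab x (And f g) |` D
  | OrL x f g G D => Lab x (Or f g) |` G =>> D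
  | OrR x f g G D => G =>> Lab x (Or f g) |` D
  | ImpL x f g G D => Lab x (Imp f g) |` G =>> D
  | ImpR x f g G D => G =>> Lab x (Imp f g) |` D
  | BoxL x a y f G D => Lab x (Box (Atom a) f) |` (Rel x a y |` G) =>> D
  | BoxR x a y f G D => G =>> Lab x (Box (Atom a) f) |` D
  | CompL x a b f G D => Lab x (Box (Comp a b) f) |` G =>> D
  | CompR x a b f G D => G =>> Lab x (Box (Comp a b) f) |` D
  | ChooseL x a b f G D => Lab x (Box (Choose a b) f) |` G =>> D
  | ChooseR x a b f G D => G =>> Lab x (Box (Choose a b) f) |` D
  | TestL x f g G D => Lab x (Box (Test f) g) |` G =>> D
  | TestR x f g G D => G =>> Lab x (Box (Test f) g) |` D
  | StarL x a f G D => Lab x (Box (Star a) f) |` G =>> D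
  | StarR x a f G D => G =>> Lab x (Box (Star a) f) |` D
  | Subst x y G D =>
      [fset subst_item x y A | A in G] =>> [fset subst_item x y A | A in D]
  | Cut A G D G' D' => G `|` G' =>> D `|` D'
  end.

Definition premises (r : rule) : seq sequent :=
  match r with
  | Ax A => [::]
  | BotL x => [::]
  | WL A G D => [:: G =>> D]
  | WR A G D => [:: G =>> D]
  | AndL x f g G D => [:: Lab x f |` (Lab x g |` G) =>> D]
  | AndR x f g G D => [:: G =>> Lab x f |` D; G =>> Lab x g |` D]
  | OrL x f g G D => [:: Lab x f |` G =>> D; Lab x g |` G =>> D]
  | OrR x f g G D => [:: G =>> Lab x f |` (Lab x g |` D)]
  | ImpL x f g G D => [:: G =>> Lab x f |` D; Lab x g |` G =>> D]
  | ImpR x f g G D => [:: Lab x f |` G =>> Lab x g |` D]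
  | BoxL x a y f G D => [:: Lab y f |` G =>> D]
  | BoxR x a y f G D => [:: Rel x a y |` G =>> Lab y f |` D]
  | CompL x a b f G D => [:: Lab x (Box a (Box b f)) |` G =>> D]
  | CompR x a b f G D => [:: G =>> Lab x (Box a (Box b f)) |` D]
  | ChooseL x a b f G D =>
      [:: Lab x (Box a f) |` (Lab x (Box b f) |` G) =>> D]
  | ChooseR x a b f G D =>
      [:: G =>> Lab x (Box a f) |` D; G =>> Lab x (Box b f) |` D]
  | TestL x f g G D => [:: G =>> Lab x f |` D; Lab x g |` G =>> D]
  | TestR x f g G D => [:: Lab x f |` G =>> Lab x g |` D]
  | StarL x a f G D =>
      [:: Lab x f |` (Lab x (Box a (Box (Star a) f)) |` G) =>> D]
  | StarR x a f G D =>
      [:: G =>> Lab x f |` D; G =>> Lab x (Box a (Box (Star a) f)) |` D]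
  | Subst x y G D => [:: G =>> D]
  | Cut A G D G' D' => [:: G =>> A |` D; A |` G' =>> D']
  end.

End Rules.

Definition side_condition (r : rule) : Prop :=
  if r is BoxR x a y f G D then fresh y (conclusion r) else True.

(* A possibly infinite tree of rule instances, addressed by sequences of premise
   indices; [t p = None] when the tree has no node at address [p]. *)
Definition proof_tree := seq nat -> option rule.

(* The last conjunct says that the children of a node are, in order, derivations
   of exactly its premises, so that no leaf is open. *)
Definition is_preproof (t : proof_tree) : Prop :=
  [/\ isSome (t [::]),
      forall p i, isSome (t (rcons p i)) -> isSome (t p)
    & forall p r, t p = Some r ->
        side_condition r /\
        forall i, omap conclusion (t (rcons p i)) = onth (premises r) i].

(* An infinite path from the root: [b n] is the index of the premise through which
   it leaves its [n]-th node and [rho n] is the rule instance at that node.  The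
   indices are part of the path because the two premises of an instance can be
   equal as sequents. *)
Definition infinite_path (t : proof_tree) (b : nat -> nat) (rho : nat -> rule) :
    Prop :=
  forall n, t (mkseq b n) = Some (rho n).

(* [TraceValue x [:: a1; ..; an] b f] is the trace value (x, a1 .. an, b, f).
   Distinct trace values can have the same labelled formula. *)
Record trace_value : Type := TraceValue {
  tlabel : label;
  spine : seq program;
  tprog : program;
  tformula : formula }.

Definition trace_item (tau : trace_value) : item :=
  Lab (tlabel tau)
    (foldr Box (Box (Star (tprog tau)) (tformula tau)) (spine tau)).

Definition trace_box (a : program) (tau : trace_value) : trace_value :=
  TraceValue (tlabel tau) (a :: spine tau) (tprog tau) (tformula tau).

Definition trace_relabel (y : label) (tau : trace_value) : trace_value :=
  TraceValue y (spine tau) (tprog tau) (tformula tau).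

(* Traces live in succedents, hence only principal formulas and immediate
   ancestors occurring on the right are recorded. *)
Definition principal_formula (r : rule) : option item :=
  match r with
  | Ax A => Some A
  | WR A _ _ => Some A
  | AndR x f g _ _ => Some (Lab x (And f g))
  | OrR x f g _ _ => Some (Lab x (Or f g))
  | ImpR x f g _ _ => Some (Lab x (Imp f g))
  | BoxR x a _ f _ _ => Some (Lab x (Box (Atom a) f))
  | CompR x a b f _ _ => Some (Lab x (Box (Comp a b) f))
  | ChooseR x a b f _ _ => Some (Lab x (Box (Choose a b) f))
  | TestR x f g _ _ => Some (Lab x (Box (Test f) g))
  | StarR x a f _ _ => Some (Lab x (Box (Star a) f))
  | _ => None
  end.

Definition principal (r : rule) (tau : trace_value) : bool :=
  principal_formula r == Some (trace_item tau).

(* Indexed by the premise. *)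
Definition ancestors (r : rule) (i : nat) : seq item :=
  match r, i with
  | AndR x f g _ _, 0 => [:: Lab x f]
  | AndR x f g _ _, 1 => [:: Lab x g]
  | OrR x f g _ _, 0 => [:: Lab x f; Lab x g]
  | ImpR x f g _ _, 0 => [:: Lab x g]
  | BoxR x a y f _ _, 0 => [:: Lab y f]
  | CompR x a b f _ _, 0 => [:: Lab x (Box a (Box b f))]
  | ChooseR x a b f _ _, 0 => [:: Lab x (Box a f)]
  | ChooseR x a b f _ _, 1 => [:: Lab x (Box b f)]
  | TestR x f g _ _, 0 => [:: Lab x g]
  | StarR x a f _ _, 0 => [:: Lab x f]
  | StarR x a f _ _, 1 => [:: Lab x (Box a (Box (Star a) f))]
  | _, _ => [::]
  end.

Definition principal_step (r : rule) (i : nat) (tau tau' : trace_value) : Prop :=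
  match r, i with
  | BoxR x a y f _ _, 0 => tau = trace_relabel x (trace_box (Atom a) tau')
  | TestR x f g _ _, 0 => tau = trace_box (Test f) tau'
  | CompR x a b f _ _, 0 =>
      exists tau'', tau = trace_box (Comp a b) tau'' /\
                    tau' = trace_box a (trace_box b tau'')
  | ChooseR x a b f _ _, 0 =>
      exists tau'', tau = trace_box (Choose a b) tau'' /\
                    tau' = trace_box a tau''
  | ChooseR x a b f _ _, 1 =>
      exists tau'', tau = trace_box (Choose a b) tau'' /\
                    tau' = trace_box b tau''
  | StarR x a f _ _, 0 => tau = trace_box (Star a) tau'
  | StarR x a f _ _, 1 => tau' = trace_box a tau
  | _, _ => False
  end.

Definition nonprincipal_step (r : rule) (tau tau' : trace_value) : Prop :=
  if r is Subst x y _ _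
  then tau = trace_relabel (subst_label x y (tlabel tau')) tau'
  else tau' = tau.

(* [(tau, tau')] is a trace pair for the conclusion and the [i]-th premise. *)
Definition trace_pair (r : rule) (i : nat) (tau tau' : trace_value) : Prop :=
  [/\ trace_item tau \in succ (conclusion r),
      exists2 s, onth (premises r) i = Some s & trace_item tau' \in succ s
    & if principal r tau
      then trace_item tau' \in ancestors r i /\ principal_step r i tau tau'
      else nonprincipal_step r tau tau'].

Definition progressing (r : rule) (tau : trace_value) : Prop :=
  principal r tau /\ spine tau = [::].

Definition trace_follows (b : nat -> nat) (rho : nat -> rule) (k : nat)
    (tau : nat -> trace_value) : Prop :=
  forall i, trace_pair (rho (i + k)) (b (i + k)) (tau i) (tau i.+1).

Definition infinitely_progressing (rho : nat -> rule) (k : nat)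
    (tau : nat -> trace_value) : Prop :=
  forall n, exists2 i, n <= i & progressing (rho (i + k)) (tau i).

Definition is_proof (t : proof_tree) : Prop :=
  is_preproof t /\
  forall b rho, infinite_path t b rho ->
    exists k tau, trace_follows b rho k tau /\ infinitely_progressing rho k tau.

Definition provable (s : sequent) : Prop :=
  exists t, is_proof t /\ omap conclusion (t [::]) = Some s.

(* Main.v *)
(** The refutation of a formula [[a1]..[an]g] at a state is a finite run through
    [a1], .., [an] into a state where [g] fails.  The rank is the least number
    of unfolding steps of such a run; it depends only on the formula and the
    state, so it is shared by all trace values with the same formula.  A refuted
    conclusion has a refuted premise, chosen along a shortest run of the
    principal formula, such that every principal step of a trace decreases the
    rank strictly and every other step preserves it.  Iterating the choice
    yields an infinite path which no trace with infinitely many principal steps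
    can follow. *)
Require Import Defs.
From mathcomp Require Import all_boot finmap.
From mathcomp Require Import boolp.

Set Implicit Arguments.
Unset Strict Implicit.
Unset Printing Implicit Defensive.

(** * Refutations of formulas by finite runs, measured by their length *)

Section Refutation.
Variable m : model.
Implicit Types (f g : formula) (a : program) (s t : state m).

(** The recursion is on the budget [n] because unfolding a star or a composition does not shrink the
    formula. All leading boxes are peeled, and the budget left over at a formula without a leading
    box is arbitrary, so [n] is an upper bound on the number of unfoldings. *)
Fixpoint refutes (n : nat) (f : formula) (s : state m) : Prop :=
  if f is Box a g then
    if n is n'.+1 then
      match a with
      | Atom p => exists2 t, prog_interp m p (s, t) & refutes n' g t
      | Comp b c => refutes n' (Box b (Box c g)) s
      | Choose b c => refutes n' (Box b g) s \/ refutes n' (Box c g) s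
      | Test h => interp m h s /\ refutes n' g s
      | Star b => refutes n' g s \/ refutes n' (Box b (Box (Star b) g)) s
      end
    else False
  else ~ interp m f s.

Lemma refutes_not_interp n f s : refutes n f s -> ~ interp m f s.
Proof.
elim: n f s => [|n IHn] [|p|f g|f g|f g|a g] s //.
case: a => [p|b c|b c|h|b] /=.
- by move=> [t st] /IHn ngt /(_ _ st).
- move=> /IHn nbc bc; apply: nbc => t st u tu.
  by apply: bc; exists t.
- by case=> /IHn nb bc; apply: nb => t st; apply: bc; [left|right].
- by move=> [hs /IHn ng] /(_ s); apply/not_implyP; split.
- case=> /IHn ng bs; apply: ng; first by apply: bs; exists 0.
  move=> t st u [k _ tu]; apply: bs; exists k.+1 => //.
  by exists t.
Qed.

(** Induction on [a] for arbitrary [g]: in a composition the first program is followed by the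
    formula [Box c g]. *)
Lemma refutes_box a g s t :
  pinterp m a (s, t) -> (exists n, refutes n g t) ->
  exists n, refutes n (Box a g) s.
Proof.
elim: a g s t => [p|b IHb c IHc|b IHb c IHc|h|b IHb] g s t /=.
- by move=> st [n ngt]; exists n.+1, t.
- move=> [u [su ut]] /(IHc _ _ _ ut) /(IHb _ _ _ su)[n nbc].
  by exists n.+1.
- by case=> [/IHb|/IHc] /[apply] -[n ng]; exists n.+1; [left|right].
- by move=> [/= <- hs] [n ngs]; exists n.+1.
(* The number of iterations decides the disjunct: zero leaves the loop, a successor runs [b] once
   with [Box (Star b) g] as target. *)
- move=> [k _]; elim: k s => [|k IHk] s /=.
    by move=> /= <- [n ngs]; exists n.+1; left.
  move=> [u [/= su ut]] /(IHk _ ut) /(IHb _ _ _ su)[n nbb].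
  by exists n.+1; right.
Qed.

Lemma not_interp_refutes f s : ~ interp m f s -> exists n, refutes n f s.
Proof.
elim: f s => [|p|f _ g _|f _ g _|f _ g _|a g IHg] s; try by exists 0.
move=> /existsNP[t] /not_implyP[st /IHg]; exact: refutes_box.
Qed.

(** The least budget is a successor, as budget 0 refutes no box. Its predecessor [n] refutes what
    remains after one unfolding and lies below every budget for the box, which is the strict
    decrease needed later. *)
Lemma box_rank a g s : ~ interp m (Box a g) s ->
  exists2 n, refutes n.+1 (Box a g) s &
    forall k, refutes k (Box a g) s -> n < k.
Proof.
move=> /not_interp_refutes[n0 r0].
have ex : exists n, `[< refutes n (Box a g) s >] by exists n0; apply/asboolP.
case: (ex_minnP ex) => -[|n] /asboolP rn min_n; first by case: rn.
by exists n => // k /asboolP /min_n.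
Qed.

End Refutation.

(** * From a falsified conclusion to a falsified premise *)

Section Descent.
Variable m : model.
Implicit Types (v : label -> state m) (r : rule) (s : sequent).

Definition falsifies v s : Prop :=
  (forall A, A \in ante s -> sat_item v A) /\
  (forall A, A \in succ s -> ~ sat_item v A).

Definition trace_formula (tau : trace_value) : formula :=
  foldr Box (Box (Star (tprog tau)) (tformula tau)) (spine tau).

Definition trace_refuted v n (tau : trace_value) : Prop :=
  refutes n (trace_formula tau) (v (tlabel tau)).

(** With an empty spine the outermost box is the star itself. *)
Lemma trace_formula_box tau : exists a g, trace_formula tau = Box a g.
Proof.
by rewrite /trace_formula; case: (spine tau) => [|a l] /=; do 2!eexists.
Qed.

(** The boolean [principal r tau], read as 0 or 1, merges strict and weak decrease into one
    inequality. All trace pairs are covered, since the path is built before a trace on it is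
    known. *)
Definition descends v v' r i : Prop :=
  forall tau tau' n, trace_pair r i tau tau' -> trace_refuted v n tau ->
  exists2 n', trace_refuted v' n' tau' & n' + principal r tau <= n.

Lemma descends_same v r i :
  (forall tau tau', nonprincipal_step r tau tau' -> tau' = tau) ->
  (forall x a g y h n, principal_formula r = Some (Lab x (Box a g)) ->
     Lab y h \in ancestors r i -> refutes n (Box a g) (v x) ->
     exists2 n', refutes n' h (v y) & n' < n) ->
  descends v v r i.
Proof.
move=> same anc tau tau' n [_ _]; case: ifP => [/eqP prin|_].
  move=> [anc_tau' _]; rewrite /trace_refuted.
  move: prin; rewrite /trace_item -/(trace_formula tau).
  have [a [g ->]] := trace_formula_box tau => prin ref.
  have [n' ref' lt] := anc _ _ _ _ _ _ prin anc_tau' ref.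
  by exists n' => //; rewrite addn1.
by move=> /same -> ref; exists n => //; rewrite addn0.
Qed.

Definition step v r : Prop :=
  exists i s v', [/\ onth (premises r) i = Some s, falsifies v' s
                   & descends v v' r i].

Local Open Scope fset_scope.

Lemma forall_fset1U (P : item -> Prop) A (G : {fset item}) :
  (forall B, B \in A |` G -> P B) <-> P A /\ (forall B, B \in G -> P B).
Proof.
split=> [PG|[PA PG] B]; last by rewrite in_fset1U => /orP[/eqP->|/PG].
by split=> [|B BG]; apply: PG; rewrite in_fset1U ?eqxx ?BG ?orbT.
Qed.

Lemma falsifies_anteU v A G D :
  falsifies v (A |` G =>> D) <-> sat_item v A /\ falsifies v (G =>> D).
Proof. by rewrite /falsifies /= forall_fset1U; tauto. Qed.

Lemma falsifies_succU v A G D :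
  falsifies v (G =>> A |` D) <-> ~ sat_item v A /\ falsifies v (G =>> D).
Proof.
by rewrite /falsifies /= (forall_fset1U (fun B => ~ sat_item v B)); tauto.
Qed.

Definition falsifiesU := (falsifies_anteU, falsifies_succU).

Lemma sat_subst_item v x y A :
  sat_item v (subst_item x y A) <-> sat_item (v \o subst_label x y) A.
Proof. by case: A. Qed.

(** Precomposing the valuation with the substitution sends the premise label of a trace to the state
    of its conclusion label, so ranks are preserved. *)
Lemma step_Subst v x y G D :
  falsifies v (conclusion (Subst x y G D)) -> step v (Subst x y G D).
Proof.
move=> [GT DF]; exists 0, (G =>> D), (v \o subst_label x y); split=> //.
  split=> A AG; rewrite -sat_subst_item; [apply: GT|apply: DF];
  exact: in_imfset.
move=> tau tau' n [_ _]; rewrite /principal /= => -> ref.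
by exists n => //; rewrite addn0.
Qed.

Definition update v (y : label) (t : state m) : label -> state m :=
  fun z => if z == y then t else v z.

Lemma sat_update v y t A :
  y \notin labels_of A -> sat_item (update v y t) A <-> sat_item v A.
Proof.
case: A => [x a z|x f] /=; rewrite !inE /update ?negb_or !(eq_sym y).
  by move=> /andP[/negbTE-> /negbTE->].
by move=> /negbTE->.
Qed.

Lemma step_BoxR v x a y f G D : side_condition (BoxR x a y f G D) ->
  falsifies v (conclusion (BoxR x a y f G D)) -> step v (BoxR x a y f G D).
Proof.
(* The fresh label [y] is sent to [t], the first successor on a shortest refuting run; freshness
   keeps the truth of the whole conclusion. *)
move=> fr fals; have /falsifies_succU[/box_rank[n [t xt ft] min_n] _] := fals.
have upd A : A \in G \/ A \in Lab x (Box (Atom a) f) |` D ->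
    sat_item (update v y t) A <-> sat_item v A.
  by move=> /fr /sat_update.
have xy : (x == y) = false.
  have /fr : Lab x (Box (Atom a) f) \in G \/
      Lab x (Box (Atom a) f) \in Lab x (Box (Atom a) f) |` D.
    by right; rewrite fset1U1.
  by rewrite inE eq_sym => /negbTE.
exists 0; eexists; exists (update v y t); split=> //.
  have [GT DF] := fals.
  apply/falsifies_anteU; split; first by rewrite /= /update xy eqxx; exact: xt.
  apply/falsifies_succU; split.
    by rewrite /= /update eqxx; exact: refutes_not_interp ft.
  split=> A AG; first by apply/upd; [left|exact: GT].
  have AD : A \in Lab x (Box (Atom a) f) |` D by rewrite in_fset1U AG orbT.
  by rewrite upd; [exact: DF|right].
move=> tau tau' k [tau_succ _]; case: ifP => [/eqP [ex ef]|_].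
  rewrite inE /trace_refuted {1 2}/trace_formula -ex -ef.
  move=> -[/eqP[ex' ef'] _] /min_n nk; exists n; rewrite ?addn1 //.
  by rewrite /trace_formula ex' ef' /update eqxx.
move=> /= -> ref; exists k; rewrite ?addn0 // /trace_refuted /update.
have /fr : trace_item tau \in G \/
    trace_item tau \in Lab x (Box (Atom a) f) |` D by right.
by rewrite inE eq_sym => /negbTE->.
Qed.

(** Covers the rules whose premise is falsified by the same valuation. The trace condition is
    vacuous unless the principal formula is a box with an ancestor in premise [i]. *)
Lemma step_same i v r :
  (if onth (premises r) i is Some s then falsifies v s else False) ->
  (forall tau tau', nonprincipal_step r tau tau' -> tau' = tau) ->
  (forall x a g y h n, principal_formula r = Some (Lab x (Box a g)) ->
     Lab y h \in ancestors r i -> refutes n (Box a g) (v x) ->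
     exists2 n', refutes n' h (v y) & n' < n) ->
  step v r.
Proof.
case prem: (onth _ i) => [s|//] fals same anc.
by exists i, s, v; split=> //; exact: descends_same.
Qed.

Lemma falsified_step v r :
  side_condition r -> falsifies v (conclusion r) -> step v r.
Proof.
case: r.
- move=> A _ [/(_ A) AT /(_ A) AF]; exfalso.
  by apply: AF (AT _); rewrite inE.
- by move=> x _ [/(_ (Lab x Bot))]; rewrite inE => /(_ (eqxx _)).
- move=> A G D _ /falsifies_anteU[_ fals].
  by apply: (@step_same 0).
- move=> A G D _ /falsifies_succU[_ fals].
  by apply: (@step_same 0).
- move=> x f g G D _ /falsifies_anteU[/= [xf xg] fals].
  by apply: (@step_same 0) => //=; rewrite !falsifiesU.
- move=> x f g G D _ /falsifies_succU[/= /not_andP[xf|xg] fals].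
    by apply: (@step_same 0) => //=; rewrite falsifiesU.
  by apply: (@step_same 1) => //=; rewrite falsifiesU.
- move=> x f g G D _ /falsifies_anteU[/= [xf|xg] fals].
    by apply: (@step_same 0) => //=; rewrite falsifiesU.
  by apply: (@step_same 1) => //=; rewrite falsifiesU.
- move=> x f g G D _ /falsifies_succU[/= /not_orP[xf xg] fals].
  by apply: (@step_same 0) => //=; rewrite !falsifiesU.
- move=> x f g G D _ /falsifies_anteU[/= [xf|xg] fals].
    by apply: (@step_same 0) => //=; rewrite falsifiesU.
  by apply: (@step_same 1) => //=; rewrite falsifiesU.
- move=> x f g G D _ /falsifies_succU[/= /not_orP[/contrapT xf xg] fals].
  by apply: (@step_same 0) => //=; rewrite !falsifiesU.
- move=> x a y f G D _ /falsifies_anteU[/= xaf /falsifies_anteU[/= xy fals]].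
  apply: (@step_same 0) => //=; rewrite falsifiesU; split=> //.
  exact: xaf.
- exact: step_BoxR.
- move=> x a b f G D _ /falsifies_anteU[/= xabf fals].
  apply: (@step_same 0) => //=; rewrite falsifiesU; split=> //.
  by move=> t xt u tu; apply: xabf; exists t.
- move=> x a b f G D _ /falsifies_succU[/box_rank[n /= ref min_n] fals].
  apply: (@step_same 0) => //=.
    by rewrite falsifiesU; split=> //; exact: refutes_not_interp ref.
  move=> _ _ _ y h k [<- <- <-]; rewrite inE => /eqP[-> ->] /min_n nk.
  by exists n.
- move=> x a b f G D _ /falsifies_anteU[/= xabf fals].
  apply: (@step_same 0) => //=; rewrite !falsifiesU.
  by split; [|split=> //] => t xt; apply: xabf; [left|right].
(* The branch taken by a shortest run selects the premise; another falsified premise might not lower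
   the rank. *)
- move=> x a b f G D _ /falsifies_succU[/box_rank[n [] ref min_n] fals].
    apply: (@step_same 0) => //=.
      by rewrite falsifiesU; split=> //; exact: refutes_not_interp ref.
    move=> _ _ _ y h k [<- <- <-]; rewrite inE => /eqP[-> ->] /min_n nk.
    by exists n.
  apply: (@step_same 1) => //=.
    by rewrite falsifiesU; split=> //; exact: refutes_not_interp ref.
  move=> _ _ _ y h k [<- <- <-]; rewrite inE => /eqP[-> ->] /min_n nk.
  by exists n.
- move=> x f g G D _ /falsifies_anteU[/= xfg fals].
  have [xf|xf] := pselect (interp m f (v x)).
    apply: (@step_same 1) => //=; rewrite falsifiesU.
    by split=> //; exact: xfg.
  by apply: (@step_same 0) => //=; rewrite falsifiesU.
- move=> x f g G D _ /falsifies_succU[/box_rank[n [xf ref] min_n] fals].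
  apply: (@step_same 0) => //=.
    rewrite !falsifiesU; split=> //; split=> //.
    exact: refutes_not_interp ref.
  move=> _ _ _ y h k [<- <- <-]; rewrite inE => /eqP[-> ->] /min_n nk.
  by exists n.
- move=> x a f G D _ /falsifies_anteU[/= xaf fals].
  apply: (@step_same 0) => //=; rewrite !falsifiesU; split.
    by apply: xaf; exists 0.
  split=> // t xt u [k _ tu]; apply: xaf; exists k.+1 => //.
  by exists t.
(* A shortest run either leaves the loop, giving the left premise, or iterates once more, giving the
   right one. *)
- move=> x a f G D _ /falsifies_succU[/box_rank[n [] ref min_n] fals].
    apply: (@step_same 0) => //=.
      by rewrite falsifiesU; split=> //; exact: refutes_not_interp ref.
    move=> _ _ _ y h k [<- <- <-]; rewrite inE => /eqP[-> ->] /min_n nk.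
    by exists n.
  apply: (@step_same 1) => //=.
    by rewrite falsifiesU; split=> //; exact: refutes_not_interp ref.
  move=> _ _ _ y h k [<- <- <-]; rewrite inE => /eqP[-> ->] /min_n nk.
  by exists n.
- move=> x y G D _; exact: step_Subst.
- move=> A G D G' D' _ [T F].
  have sub (X Y : {fset item}) B :
      (B \in X -> B \in X `|` Y) /\ (B \in Y -> B \in X `|` Y).
    by rewrite in_fsetU; split=> ->; rewrite ?orbT.
  have [AT|AF] := pselect (sat_item v A).
    apply: (@step_same 1) => //=; rewrite falsifiesU; split=> //.
    by split=> B BX; [apply: T|apply: F]; apply: (sub _ _ B).2.
  apply: (@step_same 0) => //=; rewrite falsifiesU; split=> //.
  by split=> B BX; [apply: T|apply: F]; apply: (sub _ _ B).1.
Qed.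

(** * The infinite path of counterexamples and its traces *)

Section Path.
Variable t : proof_tree.
Hypothesis pre : is_preproof t.

Record counterexample : Type := Counterexample {
  address : seq nat;
  instance : rule;
  valuation : label -> state m;
  at_address : t address = Some instance;
  falsified : falsifies valuation (conclusion instance) }.

(** The pre-proof condition supplies a rule instance above the falsified premise. The sigma type,
    obtained by choice through [cid], makes the successor a function that can be iterated. *)
Lemma counterexample_next (c : counterexample) :
  {ic : nat * counterexample | address ic.2 = rcons (address c) ic.1 /\
    descends (valuation c) (valuation ic.2) (instance c) ic.1}.
Proof.
apply: cid; case: c => p r v tp fals /=; have [_ _ /(_ _ _ tp)[sc prem]] := pre.
have [i [s [v' [ps fals' desc]]]] := falsified_step sc fals.
have := prem i; rewrite ps; case tpi : (t _) => [r'|//] /= [es].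
rewrite -es in fals'.
by exists (i, Counterexample tpi fals').
Qed.

Definition next c : counterexample := (sval (counterexample_next c)).2.
Definition branch c : nat := (sval (counterexample_next c)).1.

Variable c0 : counterexample.
Hypothesis root : address c0 = [::].

Let c n := iter n next c0.
Let b n := branch (c n).
Let rho n := instance (c n).

Lemma counterexample_path : infinite_path t b rho.
Proof.
move=> n; have <- : address (c n) = mkseq b n; last exact: at_address.
elim: n => // n IHn; rewrite mkseqS -IHn.
exact: (svalP (counterexample_next (c n))).1.
Qed.

Variables (k : nat) (tau : nat -> trace_value).
Hypothesis follows : trace_follows b rho k tau.

Let ref_at i n := trace_refuted (valuation (c (i + k))) n (tau i).

Lemma trace_descends i n :
  ref_at i n ->
  exists2 n', ref_at i.+1 n' & n' + principal (rho (i + k)) (tau i) <= n.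
Proof.
exact: (svalP (counterexample_next (c (i + k)))).2 (follows i).
Qed.

Lemma trace_nonincreasing i d n :
  ref_at i n -> exists2 n', ref_at (d + i) n' & n' <= n.
Proof.
move=> ref; elim: d => [|d [n1 /trace_descends[n' ref' le'] le1]].
  by exists n.
exists n' => //; apply: leq_trans le1.
by apply: leq_trans le'; rewrite leq_addr.
Qed.

(** Strong induction on the budget: from any index a later principal step exists, up to which the
    budget does not grow and at which it drops. The first trace value has a budget because it lies
    in a falsified succedent. *)
Lemma not_infinitely_progressing : ~ infinitely_progressing rho k tau.
Proof.
move=> prog.
have no_rank n i : ~ ref_at i n.
  elim/ltn_ind: n i => n IHn i ref; have [j ij [prin _]] := prog i.
  have := trace_nonincreasing (j - i) ref; rewrite subnK // => -[n1 ref1 le1].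
  have [n2 ref2] := trace_descends ref1; rewrite prin addn1 => lt2.
  exact: IHn (leq_trans lt2 le1) _ ref2.
have [tau_succ _ _] := follows 0.
by have /not_interp_refutes[n /no_rank] := (falsified (c k)).2 _ tau_succ.
Qed.

End Path.
End Descent.

Theorem theorem1 (G D : {fset item}) : provable (G =>> D) -> valid (G =>> D).
Proof.
case=> t [[pre traces] root] m v; apply: contrapT => /not_implyP[GT DF].
case tr : (t [::]) root => [r|//] [concl].
have fals : falsifies v (conclusion r).
  by rewrite concl; split=> // A AD AT; apply: DF; exists A.
(* A valuation violating the end sequent is a counterexample at the root, where the iteration
   starts. *)
pose c0 := Counterexample tr fals.
have path := counterexample_path pre (c0 := c0) erefl.
have [k [tau [follows]]] := traces _ _ path.
exact: not_infinitely_progressing follows.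
Qed.
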